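(* Let $n\ge 4$, let $A=(a_{ij})$ be a real symmetric $n\times n$ matrix with constant row and column sums and a constant diagonal, and let $B=(b_{ij})$ be any real $n\times n$ matrix. Let $f:S_n\to\mathbb{R}$ be defined by $$f(\sigma)=\sum_{i,j=1}^n b_{\sigma(i)\sigma(j)}\,a_{ij},$$ let $\overline f=\frac1{n!}\sum_{\sigma\in S_n}f(\sigma)$ and $f_0=f-\overline f$. Let $\tau\in S_n$ be an optimal permutation, i.e. $f_0(\tau)=\max_{\sigma\in S_n}f_0(\sigma)$. For an integer $0\le k\le n$, $k\neq 1$, let $U(\tau,k)=\{\sigma\in S_n:\operatorname{dist}(\sigma,\tau)=k\}$ and $$\alpha(n,k)=\frac{(n-k)^2-3(n-k)}{n^2-3n}.$$ Then $$\frac{1}{|U(\tau,k)|}\sum_{\sigma\in U(\tau,k)}f_0(\sigma)\ \ge\ \alpha(n,k)\,f_0(\tau).$$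
   Context: $S_n$ is the group of permutations of $\{1,\dots,n\}$. The Hamming distance is $\operatorname{dist}(\sigma,\tau)=|\{i:\sigma(i)\ne\tau(i)\}|$. ''Constant row and column sums'' means there is a number $a$ with $\sum_{i}a_{ij}=a$ for all $j$ and $\sum_j a_{ij}=a$ for all $i$; ''constant diagonal'' means there is a number $b$ with $a_{ii}=b$ for all $i$. *)

(* Defs.v *)
From mathcomp Require Import all_boot all_order all_algebra all_fingroup.
From mathcomp Require Import reals.

Set Implicit Arguments.
Unset Strict Implicit.
Unset Printing Implicit Defensive.

Import Order.TTheory GRing.Theory Num.Theory.
Local Open Scope ring_scope.

Definition constant_row_col_sums (R : realType) (n : nat) (A : 'M[R]_n) : Prop :=
  exists a : R, (forall j, \sum_(i < n) A i j = a) /\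
                (forall i, \sum_(j < n) A i j = a).

Definition constant_diagonal (R : realType) (n : nat) (A : 'M[R]_n) : Prop :=
  exists b : R, forall i, A i i = b.

Definition hamming_dist (n : nat) (s t : 'S_n) : nat :=
  #|[set i : 'I_n | s i != t i]|.

(* "qap": quadratic assignment problem *)
Definition qap (R : realType) (n : nat) (A B : 'M[R]_n) (s : 'S_n) : R :=
  \sum_(i < n) \sum_(j < n) B (s i) (s j) * A i j.

Definition qap_mean (R : realType) (n : nat) (A B : 'M[R]_n) : R :=
  (n`!)%:R^-1 * \sum_(s : 'S_n) qap A B s.

Definition qap0 (R : realType) (n : nat) (A B : 'M[R]_n) (s : 'S_n) : R :=
  qap A B s - qap_mean A B.

Definition optimal (R : realType) (n : nat) (A B : 'M[R]_n) (t : 'S_n) : Prop :=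
  forall s : 'S_n, qap0 A B s <= qap0 A B t.

Definition sphere (n : nat) (t : 'S_n) (k : nat) : {set 'S_n} :=
  [set s : 'S_n | hamming_dist s t == k].

Definition alpha (R : realType) (n k : nat) : R :=
  ((n%:R - k%:R) ^+ 2 - 3 * (n%:R - k%:R)) / (n%:R ^+ 2 - 3 * n%:R).

(* Main.v *)
(** After replacing B by its conjugate under t we may assume t = 1, and after
    subtracting multiples of the identity and of the all-ones matrix from A
    (which changes f by a constant) that A has zero diagonal and zero row sums;
    then f has mean 0.  The sums
      K(x,y,z,w) = \sum_s B(s x, s y) A(s z, s w)
    are invariant under the simultaneous action of S_n on x, y, z, w, and sum to
    0 over w.  For x <> y and z <> w this forces them to be explicit multiples
    of L = K(x,y,x,y), depending only on the coincidences between {x,y} and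
    {z,w}.  Summing K(s x, s y, x, y) over x <> y gives the average of f over
    the conjugacy class of s, namely
      f(1) (p1^2 - 3 p1 + 2 p2) / (n^2 - 3 n)
    with p1, p2 the numbers of fixed points and of 2-cycles of s (the normalized
    character of the partition (n-2,2)).  As p1 = n - k on the sphere, f(1) >= 0
    and p2 >= 0, the inequality follows by averaging over the sphere, which is
    closed under conjugation. *)
Require Import Defs.
From mathcomp Require Import all_boot all_order all_algebra all_fingroup.
From mathcomp Require Import reals.
From mathcomp Require Import zify ring lra.

Import Order.TTheory GRing.Theory Num.Theory.
Local Open Scope ring_scope.

(** * Sums with finitely many exceptional terms, and 2-transitivity *)

Lemma sum_const_off_seq (R : pzRingType) (n : nat) (F : 'I_n -> R) (c : R)
    (r : seq 'I_n) :
  uniq r -> (forall i, i \notin r -> F i = c) ->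
  \sum_i F i = \sum_(i <- r) F i + (n%:R - (size r)%:R) * c.
Proof.
move=> ur Fc; rewrite (bigID [in r]) /= -big_uniq //; congr (_ + _).
rewrite (eq_bigr (fun=> c)) // sumr_const.
rewrite -(card_uniqP ur) -[in n%:R](card_ord n) -(cardC [in r]) natrD.
by rewrite addrAC subrr add0r mulr_natl.
Qed.

Lemma perm_2transitive (T : finType) (x y x' y' : T) :
  x != y -> x' != y' -> exists p : {perm T}, p x = x' /\ p y = y'.
Proof.
move=> xy xy'; exists (tperm x x' * tperm (tperm x x' y) y')%g.
rewrite !permM tpermL tpermL; split=> //.
rewrite tpermD // 1?eq_sym //.
by rewrite -[X in X != _](tpermL x x') (inj_eq perm_inj).
Qed.

(** * The invariant sums K(x,y,z,w) *)

Definition pair_sum {R : realFieldType} {n : nat} (A B : 'M[R]_n)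
    (x y z w : 'I_n) : R :=
  \sum_(s : 'S_n) B (s x) (s y) * A (s z) (s w).

Lemma pair_sum_perm (R : realFieldType) (n : nat) (A B : 'M[R]_n) (p : 'S_n)
    (x y z w : 'I_n) :
  pair_sum A B (p x) (p y) (p z) (p w) = pair_sum A B x y z w.
Proof.
rewrite /pair_sum [RHS](reindex_inj (mulgI p)) /=.
by apply: eq_bigr => s _; rewrite !permM.
Qed.

Lemma pair_sum_diag (R : realFieldType) (n : nat) (A B : 'M[R]_n) (x y z : 'I_n) :
  (forall i, A i i = 0) -> pair_sum A B x y z z = 0.
Proof. by move=> A0; rewrite /pair_sum big1 // => s _; rewrite A0 mulr0. Qed.

Lemma pair_sum_sym (R : realFieldType) (n : nat) (A B : 'M[R]_n) (x y z w : 'I_n) :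
  (forall i j, A i j = A j i) -> pair_sum A B x y z w = pair_sum A B x y w z.
Proof. by move=> As; apply: eq_bigr => s _; rewrite [A _ _]As. Qed.

Lemma pair_sum_row (R : realFieldType) (n : nat) (A B : 'M[R]_n) (x y z : 'I_n) :
  (forall i, \sum_j A i j = 0) -> \sum_w pair_sum A B x y z w = 0.
Proof.
move=> Ar; rewrite exchange_big big1 //= => s _; rewrite -mulr_sumr.
by rewrite -(reindex_inj (@perm_inj _ s) (P := xpredT) (F := A (s z))) Ar mulr0.
Qed.

Lemma pair_sum_fresh (R : realFieldType) (n : nat) (A B : 'M[R]_n)
    (x y z w w' : 'I_n) :
  w \notin [:: x; y; z] -> w' \notin [:: x; y; z] ->
  pair_sum A B x y z w = pair_sum A B x y z w'.
Proof.
rewrite !inE !negb_or => /and3P[wx wy wz] /and3P[wx' wy' wz'].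
by rewrite -(pair_sum_perm _ _ _ _ (tperm w w')) tpermL !tpermD.
Qed.

Section PairSumValues.
Variables (R : realFieldType) (n : nat) (A B : 'M[R]_n).
Hypotheses (A0 : forall i, A i i = 0)
  (As : forall i j, A i j = A j i) (Ar : forall i, \sum_j A i j = 0).

(** In the vanishing sum over the last argument, one term is diagonal, one is L, and the other n - 2
    are equal by [pair_sum_fresh]. *)
Lemma pair_sum_one_common (x y w : 'I_n) : x != y -> w \notin [:: x; y] ->
  (n%:R - 2) * pair_sum A B x y x w = - pair_sum A B x y x y /\
  (n%:R - 2) * pair_sum A B x y y w = - pair_sum A B x y x y.
Proof.
move=> xy wxy; have uxy : uniq [:: x; y] by rewrite /= inE xy.
split.
- have /eqP := pair_sum_row _ _ A B x y x Ar.
  rewrite (sum_const_off_seq _ _ _ (pair_sum A B x y x w) _ uxy) => [|i ixy].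
    by rewrite !big_cons big_nil pair_sum_diag //= => /eqP; lra.
  by apply: pair_sum_fresh; move: ixy wxy; rewrite !inE; do 4!case: eqP.
- have /eqP := pair_sum_row _ _ A B x y y Ar.
  rewrite (sum_const_off_seq _ _ _ (pair_sum A B x y y w) _ uxy) => [|i ixy].
    rewrite !big_cons big_nil (pair_sum_diag _ _ _ _ x y y) //=.
    by rewrite (pair_sum_sym _ _ _ _ x y y x) // => /eqP; lra.
  by apply: pair_sum_fresh; move: ixy wxy; rewrite !inE; do 4!case: eqP.
Qed.

(** In the sum of K(x,y,z,.), the terms at x and y are -L / (n - 2) each, the one at z is 0, and n -
    3 equal terms remain. *)
Lemma pair_sum_none_common (x y z w : 'I_n) : uniq [:: x; y; z; w] ->
  (n%:R - 2) * (n%:R - 3) * pair_sum A B x y z w = 2 * pair_sum A B x y x y.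
Proof.
move=> u4; have /eqP := pair_sum_row _ _ A B x y z Ar.
have [u3 wxyz] : uniq [:: x; y; z] /\ w \notin [:: x; y; z].
  have: uniq (rcons [:: x; y; z] w) by [].
  by rewrite rcons_uniq => /andP[].
rewrite (sum_const_off_seq _ _ _ (pair_sum A B x y z w) _ u3); last first.
  by move=> i i3; apply: pair_sum_fresh.
rewrite !big_cons big_nil (pair_sum_diag _ _ _ _ x y z) //=.
rewrite !(pair_sum_sym _ _ _ _ x y z _ As) (pair_sum_sym _ _ _ _ x y w z As).
have [xy zxy] : x != y /\ z \notin [:: x; y].
  by move: u3; rewrite /= !inE !negb_or => /andP[/andP[-> xz] /andP[yz _]];
     rewrite eq_sym xz eq_sym yz.
have [Ex Ey] := pair_sum_one_common x y z xy zxy => /eqP E.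
(* The factor n - 2 lets [Ex] and [Ey] apply without division. *)
have := congr1 ( *%R (n%:R - 2)) E.
rewrite mulr0 !mulrDr Ex Ey; lra.
Qed.

(** One polynomial in the indicators covers all cases, ready to be summed: it equals 2 for disjoint
    pairs, 2 - (n - 1) = -(n - 3) for one common index, and (n - 2)(n - 3) for equal pairs. *)
Lemma pair_sum_value (x y z w : 'I_n) : x != y -> z != w ->
  (n%:R - 2) * (n%:R - 3) * pair_sum A B x y z w =
  (2 - (n%:R - 1) * ((x == z)%:R + (y == w)%:R + (x == w)%:R + (y == z)%:R)
     + (n%:R - 1) * (n%:R - 2)
       * ((x == z)%:R * (y == w)%:R + (x == w)%:R * (y == z)%:R))
  * pair_sum A B x y x y.
Proof.
have common w' : x != y -> w' != x -> w' != y ->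
    (n%:R - 2) * pair_sum A B x y x w' = - pair_sum A B x y x y /\
    (n%:R - 2) * pair_sum A B x y y w' = - pair_sum A B x y x y.
  by move=> xy w'x w'y; apply: pair_sum_one_common; rewrite // !inE negb_or w'x.
move=> xy zw; have yx : y != x by rewrite eq_sym.
case: (eqVneq z x) zw => [->|zx] zw.
  have wx : w != x by rewrite eq_sym.
  rewrite (negPf yx) (eq_sym x w) (negPf wx).
  case: (eqVneq w y) => [->|wy]; first by rewrite /=; ring.
  by have [E _] := common w xy wx wy; rewrite /=; nra.
case: (eqVneq z y) zw => [->|zy] zw.
  have wy : w != y by rewrite eq_sym.
  rewrite (eq_sym y w) (negPf wy).
  case: (eqVneq w x) => [->|wx]; first by rewrite (pair_sum_sym _ _ _ _ x y y x) //=; ring.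
  by have [_ E] := common w xy wx wy; rewrite /=; nra.
have [Ex Ey] := common z xy zx zy.
case: (eqVneq w x) zw => [->|wx] zw.
  by rewrite (negPf yx) (pair_sum_sym _ _ _ _ x y z x) //=; nra.
case: (eqVneq w y) zw => [->|wy] zw.
  by rewrite (pair_sum_sym _ _ _ _ x y z y) //=; nra.
rewrite pair_sum_none_common /=; first by ring.
by rewrite !inE !negb_or xy !(eq_sym x) !(eq_sym y) zx wx zy wy zw.
Qed.

End PairSumValues.

(** * Conjugation, fixed points and Hamming spheres *)

(** After reindexing by [w], the conjugate sends [w x] to [w (s x)]. *)
Lemma sum_qap_conj (R : realType) (n : nat) (A B : 'M[R]_n) (s : 'S_n) :
  \sum_(w : 'S_n) qap A B (s ^ w)%g
    = \sum_x \sum_y pair_sum A B (s x) (s y) x y.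
Proof.
rewrite /pair_sum; under [RHS]eq_bigr do rewrite exchange_big /=.
rewrite [RHS]exchange_big /=; apply: eq_bigr => w _.
rewrite /qap (reindex_inj (@perm_inj _ w)) /=; apply: eq_bigr => x _.
rewrite (reindex_inj (@perm_inj _ w)) /=; apply: eq_bigr => y _.
by rewrite !permJ.
Qed.

Lemma sum_perm_eq (R : pzRingType) (n : nat) (s : 'S_n) (x : 'I_n) :
  \sum_y ((s x == y)%:R : R) = 1 /\ \sum_y ((s y == x)%:R : R) = 1.
Proof.
split.
  by rewrite (bigD1 (s x)) //= eqxx big1 ?addr0 // => y /negPf; rewrite eq_sym => ->.
rewrite (bigD1 ((s^-1)%g x)) //= permKV eqxx big1 ?addr0 // => y.
by rewrite -(inj_eq (@perm_inj _ s)) permKV => /negPf ->.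
Qed.

Lemma mem_sphere_mulr (n : nat) (t : 'S_n) (k : nat) (s : 'S_n) :
  ((s * t)%g \in sphere t k) = (s \in sphere 1%g k).
Proof.
rewrite !inE /hamming_dist; congr (_ == _).
by apply: eq_card => i; rewrite !inE permM (inj_eq perm_inj) perm1.
Qed.

(** [w] maps the points moved by [s] onto those moved by its conjugate. *)
Lemma mem_sphere1_conj (n k : nat) (s w : 'S_n) :
  ((s ^ w)%g \in sphere 1%g k) = (s \in sphere 1%g k).
Proof.
rewrite !inE /hamming_dist -[in RHS](card_imset _ (@perm_inj _ w)).
congr (_ == _); apply: eq_card => i; rewrite -(permKV w i).
by rewrite (mem_imset _ _ perm_inj) !inE permJ !perm1 (inj_eq perm_inj).
Qed.

Lemma sum_fixed_sphere1 (R : pzRingType) (n k : nat) (s : 'S_n) :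
  s \in sphere 1%g k -> \sum_x ((s x == x)%:R : R) = n%:R - k%:R.
Proof.
rewrite inE => /eqP <-.
have -> : \sum_x ((s x == x)%:R : R) = (#|[set x | s x == x]|)%:R.
  by rewrite -sum1dep_card natr_sum [RHS]big_mkcond; apply: eq_bigr => x _; case: eqP.
rewrite -[in n%:R](card_ord n) -(cardsC [set x | s x == x]) natrD /hamming_dist.
suff -> : ~: [set x | s x == x] = [set x | s x != (1%g : 'S_n) x] by rewrite addrK.
by apply/setP => x; rewrite !inE perm1.
Qed.

Lemma sphere1_gt0 (n k : nat) : (k <= n)%N -> k <> 1%N ->
  (0 < #|sphere (1%g : 'S_n) k|)%N.
Proof.
case: n => [|n] kn k1; apply/card_gt0P.
  by exists 1%g; rewrite inE /hamming_dist eq_card0 => [|[]//]; lia.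
(* The cycle i -> i + 1 on {0, ..., k - 1}, fixing everything else. *)
pose f i := if (i.+1 < k)%N then i.+1 else if i.+1 == k then 0%N else i.
have f_lt (i : 'I_n.+1) : (f i < n.+1)%N.
  by have := ltn_ord i; rewrite /f; case: ifP; [lia|case: ifP; lia].
pose F i := Ordinal (f_lt i).
have F_inj : injective F.
  move=> i j /(congr1 val) /= E; apply: val_inj => /=; move: E; rewrite /f.
  by do ![case: ifP]; lia.
exists (perm F_inj); rewrite inE /hamming_dist; apply/eqP.
(* The moved points are to be the image of ['I_k] in ['I_n.+1]. *)
have widen_inj : injective (widen_ord kn).
  by move=> i j /(congr1 val) /= E; apply: val_inj.
rewrite -[RHS](card_ord k) -(card_imset _ widen_inj).
apply: eq_card => i; rewrite inE permE perm1 -val_eqE /= /f.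
apply/idP/imsetP => [ik|[j _ ->] /=].
  have lt_ik : (i < k)%N by move: ik; do ![case: ifP]; lia.
  by exists (Ordinal lt_ik) => //; apply: val_inj.
(* The point k - 1 goes to 0, which is a different point because k is not 1. *)
by have := ltn_ord j; do ![case: ifP]; lia.
Qed.

(** * The inequality around the identity, for zero diagonal and zero row sums *)

Section NormalizedMatrix.
Variables (R : realType) (n : nat) (A B : 'M[R]_n).
Hypotheses (hn : (4 <= n)%N) (A0 : forall i, A i i = 0)
  (As : forall i j, A i j = A j i) (Ar : forall i, \sum_j A i j = 0).

(** For fixed x, the sum of B (s x) (s y) over s is the same for all y other than x, so it factors
    out of a zero row sum of A; the term y = x vanishes with the diagonal. *)
Lemma sum_qap_eq0 : \sum_(s : 'S_n) qap A B s = 0.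
Proof.
rewrite /qap exchange_big big1 //= => x _; rewrite exchange_big /=.
under eq_bigr do rewrite -mulr_suml.
have [y xy] : exists y, y != x.
  have : (0 < #|predC1 x|)%N by rewrite cardC1 card_ord; lia.
  by case/card_gt0P => y; exists y.
rewrite (eq_bigr (fun j => (\sum_(s : 'S_n) B (s x) (s y)) * A x j)) => [|j _].
  by rewrite -mulr_sumr Ar mulr0.
have [->|jx] := eqVneq j x; first by rewrite A0 !mulr0.
congr (_ * _); rewrite (reindex_inj (mulgI (tperm j y))) /=.
by apply: eq_bigr => s _; rewrite !permM tpermL tpermD.
Qed.

Lemma average_conj_ge (s : 'S_n) (p1 := \sum_x ((s x == x)%:R : R)) :
  0 <= qap A B 1 ->
  (p1 ^+ 2 - 3 * p1) * ((n`!)%:R * qap A B 1)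
    <= (n%:R ^+ 2 - 3 * n%:R) * \sum_(w : 'S_n) qap A B (s ^ w)%g.
Proof.
move=> f_ge0; pose N : R := n%:R.
have N4 : 4 <= N by rewrite ler_nat.
have lt0n : (0 < n)%N by lia.
have lt1n : (1 < n)%N by lia.
pose L := pair_sum A B (Ordinal lt0n) (Ordinal lt1n) (Ordinal lt0n) (Ordinal lt1n).
have KL x y : x != y -> pair_sum A B x y x y = L.
  move=> xy; have [//|p [<- <-]] := perm_2transitive _ (Ordinal lt0n) (Ordinal lt1n) x y _ xy.
  by rewrite pair_sum_perm.
(* The coefficient of [pair_sum_value] at (s x, s y, x, y). *)
pose g x y : R := 2 - (N - 1) * ((s x == x)%:R + (s y == y)%:R + (s x == y)%:R + (s y == x)%:R)
   + (N - 1) * (N - 2) * ((s x == x)%:R * (s y == y)%:R + (s x == y)%:R * (s y == x)%:R).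
(* The case s = 1 relates f(1) to L and gives L its sign. *)
have sum1 : \sum_(w : 'S_n) qap A B (1 ^ w)%g = N * (N - 1) * L.
  rewrite sum_qap_conj (eq_bigr (fun=> (N - 1) * L)) => [|x _].
    by rewrite sumr_const card_ord -mulr_natl mulrA.
  rewrite (sum_const_off_seq _ _ _ L [:: x]) //= => [|y].
    by rewrite big_seq1 pair_sum_diag // add0r.
  by rewrite inE !perm1 eq_sym => /KL.
have {sum1}f1 : (n`!)%:R * qap A B 1 = N * (N - 1) * L.
  rewrite -sum1 (eq_bigr (fun=> qap A B 1)) => [|w _]; last by rewrite conj1g.
  by rewrite sumr_const card_Sn mulr_natl.
have L_ge0 : 0 <= L.
  have : 0 <= N * (N - 1) * L by rewrite -f1 mulr_ge0.
  by rewrite pmulr_rge0 // mulr_gt0; lra.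
(* [D] counts the x with s (s x) = x, so it is p1 + 2 p2. *)
pose D := \sum_x \sum_y ((s x == y)%:R * (s y == x)%:R : R).
have D_ge : p1 <= D.
  apply: ler_sum => x _; rewrite (bigD1 x) //= -natrM mulnb andbb lerDl.
  by apply: sumr_ge0 => y _; rewrite mulr_ge0.
have sumc (c : R) : \sum_(i < n) c = N * c by rewrite sumr_const card_ord mulr_natl.
have sum_g : \sum_x \sum_y g x y
    = 2 * N ^+ 2 - (N - 1) * (2 * N * p1 + 2 * N) + (N - 1) * (N - 2) * (p1 ^+ 2 + D).
  rewrite (eq_bigr (fun x => (2 * N - (N - 1) * (p1 + 2)) + (- (N - 1) * N + (N - 1) * (N - 2) * p1) * (s x == x)%:R
    + (N - 1) * (N - 2) * \sum_y ((s x == y)%:R * (s y == x)%:R : R))) => [|x _].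
    by rewrite 2!big_split /= sumc -!mulr_sumr -/p1 -/D; ring.
  have [S1 S2] := sum_perm_eq R n s x.
  rewrite /g !big_split /= sumrN -!mulr_sumr !big_split /= -!mulr_sumr S1 S2 -/p1 !sumc.
  by ring.
(* The value formula needs x and y distinct, so the diagonal of [g] is subtracted. *)
have sum_g_diag : \sum_x g x x = 2 * N - 4 * (N - 1) * p1 + 2 * (N - 1) * (N - 2) * p1.
  rewrite (eq_bigr (fun x => 2 + (- 4 * (N - 1) + 2 * (N - 1) * (N - 2)) * (s x == x)%:R)) => [|x _].
    by rewrite big_split /= -mulr_sumr -/p1 sumc; ring.
  by rewrite /g; case: eqP => _ /=; ring.
have sumE : (N - 2) * (N - 3) * \sum_(w : 'S_n) qap A B (s ^ w)%g
    = (\sum_x \sum_y g x y - \sum_x g x x) * L.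
  rewrite sum_qap_conj mulr_sumr -sumrB mulr_suml; apply: eq_bigr => x _.
  rewrite mulr_sumr (bigD1 x) //= (bigD1 x (F := g x)) //= addrC addrAC subrr add0r.
  rewrite pair_sum_diag // mulr0 addr0 mulr_suml; apply: eq_bigr => y yx.
  have xy : x != y by rewrite eq_sym.
  have sxy : s x != s y by rewrite (inj_eq perm_inj).
  by rewrite pair_sum_value // (KL _ _ sxy).
(* The terms free of p1 and D cancel, and N - 2 divides the rest. *)
have {sumE}sumE : (N - 3) * \sum_(w : 'S_n) qap A B (s ^ w)%g
    = (N - 1) * (p1 ^+ 2 + D - 4 * p1) * L.
  have N2 : N - 2 != 0 by rewrite subr_eq0; apply/eqP; lra.
  by apply: (mulfI N2); rewrite mulrA sumE sum_g sum_g_diag; ring.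
rewrite f1 -/N.
have -> : (N ^+ 2 - 3 * N) * \sum_(w : 'S_n) qap A B (s ^ w)%g
   = (p1 ^+ 2 - 3 * p1) * (N * (N - 1) * L) + N * (N - 1) * L * (D - p1).
  transitivity (N * ((N - 3) * \sum_(w : 'S_n) qap A B (s ^ w)%g)); first by ring.
  by rewrite sumE; ring.
by rewrite lerDl mulr_ge0 ?subr_ge0 // !mulr_ge0 //; lra.
Qed.

Lemma sphere1_average_ge (k : nat) : (k <= n)%N -> (0 < #|sphere (1%g : 'S_n) k|)%N ->
  0 <= qap A B 1 ->
  alpha R n k * qap A B 1
    <= (#|sphere (1%g : 'S_n) k|)%:R^-1 * \sum_(s in sphere (1%g : 'S_n) k) qap A B s.
Proof.
move=> kn S_gt0 f_ge0; set S := sphere 1%g k in S_gt0 *.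
have N4 : 4 <= n%:R :> R by rewrite ler_nat.
have den_gt0 : 0 < n%:R ^+ 2 - 3 * n%:R :> R by nra.
have fact_gt0R : 0 < (n`!)%:R :> R by rewrite ltr0n fact_gt0.
rewrite ler_pdivlMl ?ltr0n // -(ler_pM2l fact_gt0R) -(ler_pM2l den_gt0).
(* Conjugation by each fixed [w] permutes [S], so every [w] contributes the whole sum over [S]. *)
have -> : (n`!)%:R * \sum_(s in S) qap A B s
    = \sum_(s in S) \sum_(w : 'S_n) qap A B (s ^ w)%g.
  rewrite [RHS]exchange_big [RHS](eq_bigr (fun=> \sum_(s in S) qap A B s)) => [|w _].
    by rewrite sumr_const card_Sn mulr_natl.
  rewrite [RHS](reindex_inj (@conjg_inj _ w)) /=.
  by apply: eq_bigl => s; rewrite mem_sphere1_conj.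
rewrite [leRHS]mulr_sumr.
have -> : (n%:R ^+ 2 - 3 * n%:R) * ((n`!)%:R * ((#|S|)%:R * (alpha R n k * qap A B 1)))
    = \sum_(s in S) ((n%:R - k%:R) ^+ 2 - 3 * (n%:R - k%:R)) * ((n`!)%:R * qap A B 1).
  rewrite sumr_const -[_ *+ #|S|]mulr_natl /alpha; field.
  by apply/eqP => /eqP; rewrite gt_eqF.
apply: ler_sum => s /(sum_fixed_sphere1 R) <-.
exact: average_conj_ge.
Qed.

End NormalizedMatrix.

(** * Reduction of the general case to the normalized one *)

Theorem theorem2p1 (R : realType) (n : nat) (hn : (4 <= n)%N)
    (A B : 'M[R]_n)
    (hAsym : A^T = A)
    (hAsums : constant_row_col_sums A)
    (hAdiag : constant_diagonal A)
    (t : 'S_n) (ht : optimal A B t)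
    (k : nat) (hkn : (k <= n)%N) (hk1 : k <> 1%N) :
  alpha R n k * qap0 A B t
    <= (#|sphere t k|)%:R^-1 * \sum_(s in sphere t k) qap0 A B s.
Proof.
have [a [_ Aa]] := hAsums; have [b Ab] := hAdiag.
have N4 : 4 <= n%:R :> R by rewrite ler_nat.
have fact_gt0R : 0 < (n`!)%:R :> R by rewrite ltr0n fact_gt0.
(* These solve c + d = b and n c + d = a, the conditions for zero diagonal and zero row sums. *)
pose c := (a - b) / (n%:R - 1); pose d := b - c.
pose A' : 'M[R]_n := A - const_mx c - d%:M.
(* Products apply the left factor first, so [(s * t) i] is [t (s i)] and [B'] absorbs [t]. *)
pose B' : 'M[R]_n := \matrix_(i, j) B (t i) (t j).
have A0 i : A' i i = 0 by rewrite !mxE eqxx mulr1n Ab /d; ring.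
have As i j : A' i j = A' j i.
  by rewrite !mxE -[A in LHS]hAsym mxE (eq_sym i j).
have Ar i : \sum_j A' i j = 0.
  under eq_bigr do rewrite !mxE.
  rewrite !big_split /= Aa sumr_const card_ord (bigD1 i) //= eqxx big1 => [|j].
    rewrite mulr1n -mulr_natl /d /c; field.
    by apply/eqP; lra.
  by rewrite eq_sym => /negPf ->; rewrite mulr0n oppr0.
(* The removed parts of A contribute the entry sum and the trace of B, which relabelling by [s]
   preserves. *)
pose e := c * (\sum_i \sum_j B i j) + d * \sum_i B i i.
have qapE s : qap A B s = qap A' B s + e.
  have -> : e = c * (\sum_i \sum_j B (s i) (s j)) + d * \sum_i B (s i) (s i).
    rewrite /e (reindex_inj (@perm_inj _ s)) /=.
    rewrite [\sum_i B i i](reindex_inj (@perm_inj _ s)) /=.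
    congr (c * _ + _); apply: eq_bigr => i _.
    by rewrite (reindex_inj (@perm_inj _ s)).
  rewrite !mulr_sumr -!big_split /=; apply: eq_bigr => i _.
  rewrite mulr_sumr addrA -big_split /=.
  rewrite [LHS](bigD1 i) //= [in RHS](bigD1 i) //= !mxE eqxx mulr1n.
  rewrite [X in _ + X = _](eq_bigr (fun j => B (s i) (s j) * A' i j + c * B (s i) (s j))) => [|j ji].
    by ring.
  by rewrite !mxE eq_sym (negPf ji) mulr0n; ring.
have qap0E s : qap0 A B (s * t)%g = qap A' B' s.
  rewrite /qap0 /qap_mean (eq_bigr _ (fun s _ => qapE s)) big_split /=.
  rewrite sum_qap_eq0 // add0r sumr_const card_Sn -[e *+ _]mulr_natl mulKf ?gt_eqF //.
  rewrite qapE addrK; apply: eq_bigr => i _; apply: eq_bigr => j _.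
  by rewrite !mxE !permM.
have qap0t : qap0 A B t = qap A' B' 1 by rewrite -qap0E mul1g.
(* The maximum of a function with zero sum is nonnegative. *)
have f_ge0 : 0 <= qap A' B' 1.
  have : \sum_(s : 'S_n) qap A' B' s <= \sum_(s : 'S_n) qap A' B' 1.
    by apply: ler_sum => s _; rewrite -qap0t -qap0E; apply: ht.
  by rewrite sum_qap_eq0 // sumr_const card_Sn pmulrn_lge0 ?fact_gt0.
have -> : \sum_(s in sphere t k) qap0 A B s = \sum_(s in sphere (1%g : 'S_n) k) qap A' B' s.
  rewrite (reindex_inj (mulIg t)) /=.
  by apply: eq_big => [s|s _]; rewrite ?mem_sphere_mulr.
rewrite qap0t -[#|sphere t k|]sum1_card (reindex_inj (mulIg t)) /=.
rewrite (eq_bigl _ _ (mem_sphere_mulr _ t k)) sum1_card.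
by apply: sphere1_average_ge => //; apply: sphere1_gt0.
Qed.
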